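(* Let $K$ be a field, let $r\ge 3$ be an integer, and let $R=K[x_1,\dots,x_r]$. Let $\mathfrak{J}_r=(x_1^r,\dots,x_r^r,\,x_1\cdots x_{r-1}(x_1+x_r))$ and $I_{r,r}=(x_1^r,\dots,x_r^r,\,x_1\cdots x_r)$. Then $R/\mathfrak{J}_r$ and $R/I_{r,r}$ have the same Hilbert function.
   Context: The Hilbert function of a standard graded $K$-algebra $A$ is $h_A(j)=\dim_K A_j$. *)

(* Defs.v *)
From HB Require Import structures.
From mathcomp Require Import all_boot all_algebra ring_quotient.
From mathcomp Require Import mpoly.
From mathcomp Require Import boolp.

Set Implicit Arguments.
Unset Strict Implicit.
Unset Printing Implicit Defensive.

Import GRing.Theory.
Local Open Scope ring_scope.
Local Open Scope quotient_scope.

Section FiniteDimension.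
Variables (K : fieldType) (V : lmodType K).

Definition is_basis (S : V -> Prop) n (b : 'I_n -> V) : Prop :=
  [/\ forall i, S (b i),
      forall c : 'I_n -> K, \sum_i c i *: b i = 0 -> forall i, c i = 0 &
      forall v, S v -> exists c : 'I_n -> K, v = \sum_i c i *: b i].

Definition has_dim (S : V -> Prop) (n : nat) : Prop :=
  exists b : 'I_n -> V, is_basis S b.

Lemma has_dim_le S m n : has_dim S m -> has_dim S n -> (m <= n)%N.
Proof.
move=> [b [Sb freeb _]] [b' [_ _ genb']].
have /choice[c cE] : forall i, exists c : 'I_n -> K, b i = \sum_j c j *: b' j.
  by move=> i; apply/genb'/Sb.
pose M : 'M_(m, n) := \matrix_(i, j) c i j.
suff /eqP <- : row_free M by exact: rank_leq_col.
apply: inj_row_free => v vM0; apply/rowP => i; rewrite mxE.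
apply: (freeb (fun i => v 0 i)).
under eq_bigr => k _ do rewrite cE scaler_sumr.
rewrite exchange_big big1 //= => j _.
under eq_bigr => k _ do rewrite scalerA.
rewrite -scaler_suml; move/rowP/(_ j): vM0; rewrite !mxE => vM0.
by under eq_bigr => k _ do rewrite -[c k j](mxE matrix_key (fun i j => c i j));
   rewrite vM0 scale0r.
Qed.

Lemma has_dim_uniq S m n : has_dim S m -> has_dim S n -> m = n.
Proof. by move=> Sm Sn; apply/eqP; rewrite eqn_leq !(@has_dim_le S). Qed.

Lemma has_dim_span S n (b : 'I_n -> V) :
    (forall i, S (b i)) ->
    (forall v, S v -> exists c : 'I_n -> K, v = \sum_i c i *: b i) ->
  exists m, has_dim S m.
Proof.
elim: n b => [|n IHn] b Sb genb.
  by exists 0%N, b; split=> // c _ [].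
have [freeb|] := pselect (forall c : 'I_n.+1 -> K,
  \sum_i c i *: b i = 0 -> forall i, c i = 0); first by exists n.+1, b.
move=> /existsNP[c /not_implyP[cb0 /existsNP[i /eqP ci0]]].
apply: (IHn (b \o lift i)) => [k|v /genb[d ->]]; first exact: Sb.
have biE : b i = \sum_k (- (c i)^-1 * c (lift i k)) *: b (lift i k).
  under eq_bigr => k _ do rewrite -scalerA.
  rewrite -scaler_sumr; move: cb0; rewrite (bigD1_ord i) //=.
  move/eqP; rewrite addrC addr_eq0 => /eqP ->.
  by rewrite scalerN scaleNr opprK scalerA mulVf // scale1r.
exists (fun k => d i * (- (c i)^-1 * c (lift i k)) + d (lift i k)).
rewrite (bigD1_ord i) //= biE scaler_sumr -big_split /=.
by apply: eq_bigr => k _; rewrite scalerDl scalerA.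
Qed.

End FiniteDimension.

Section QuotientByIdeal.
Variables (K : fieldType) (r : nat) (G : seq {mpoly K[r]}).

(* The ideal generated by G, as a boolean predicate: ring_quotient only
   forms quotients by decidable subgroups. *)
Definition ideal_of (f : {mpoly K[r]}) : bool :=
  `[< exists c : 'I_(size G) -> {mpoly K[r]}, f = \sum_i c i * G`_i >].

Lemma ideal_ofMl f g : g \in ideal_of -> f * g \in ideal_of.
Proof.
move=> /asboolP[c ->]; apply/asboolP; exists (fun i => f * c i).
by rewrite mulr_sumr; apply: eq_bigr => i _; rewrite mulrA.
Qed.

Lemma ideal_of_zmod : zmod_closed ideal_of.
Proof.
split=> [|f g /asboolP[c ->] /asboolP[d ->]].
  by apply/asboolP; exists (fun=> 0); rewrite big1 // => i _; rewrite mul0r.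
apply/asboolP; exists (fun i => c i - d i).
by rewrite -sumrB; apply: eq_bigr => i _; rewrite mulrBl.
Qed.

HB.instance Definition _ :=
  GRing.isZmodClosed.Build {mpoly K[r]} ideal_of ideal_of_zmod.

Definition ideal_gen := Algebra.ZmodClosed.clone _ ideal_of _.

(* Only the K-vector space structure of the quotient is set up: it is all that
   the Hilbert function needs, and it exists without assuming that the ideal is
   proper. *)
Definition quo := {ideal_quot ideal_gen}.

HB.instance Definition _ := GRing.Zmodule.on quo.
HB.instance Definition _ := EqQuotient.on quo.

Definition quo_pi (f : {mpoly K[r]}) : quo := \pi_quo f.

Definition quo_scale (a : K) (x : quo) : quo := quo_pi (a *: repr x).

Lemma quo_piB f g : quo_pi (f - g) = quo_pi f - quo_pi g.
Proof. exact: (raddfB \pi_{ideal_quot ideal_gen}). Qed.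

Lemma quo_piD f g : quo_pi (f + g) = quo_pi f + quo_pi g.
Proof. exact: (raddfD \pi_{ideal_quot ideal_gen}). Qed.

Lemma quo_pi_eq f g : quo_pi f = quo_pi g <-> f - g \in ideal_of.
Proof. by rewrite Quotient.idealrBE; split=> /eqP. Qed.

Lemma quo_piK x : quo_pi (repr x) = x.
Proof. exact: reprK. Qed.

Lemma quo_scale_pi a f : quo_scale a (quo_pi f) = quo_pi (a *: f).
Proof.
apply/quo_pi_eq; rewrite -scalerBr -mul_mpolyC; apply: ideal_ofMl.
by apply/quo_pi_eq; rewrite quo_piK.
Qed.

Fact quo_scaleA a b x : quo_scale a (quo_scale b x) = quo_scale (a * b) x.
Proof. by rewrite -[x]quo_piK !quo_scale_pi scalerA. Qed.

Fact quo_scale1 : left_id 1 quo_scale.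
Proof. by move=> x; rewrite -[x]quo_piK !quo_scale_pi scale1r. Qed.

Fact quo_scaleDr : right_distributive quo_scale +%R.
Proof.
move=> a x y; rewrite -[x]quo_piK -[y]quo_piK -quo_piD !quo_scale_pi.
by rewrite scalerDr quo_piD.
Qed.

Fact quo_scaleDl x : {morph quo_scale^~ x : a b / a + b}.
Proof.
by move=> a b; rewrite -[x]quo_piK !quo_scale_pi scalerDl quo_piD.
Qed.

HB.instance Definition _ := GRing.Zmodule_isLmodule.Build K quo
  quo_scaleA quo_scale1 quo_scaleDr quo_scaleDl.

Fact quo_pi_is_linear : linear quo_pi.
Proof. by move=> a f g; rewrite quo_piD -quo_scale_pi. Qed.

HB.instance Definition _ :=
  GRing.isLinear.Build K {mpoly K[r]} quo _ quo_pi quo_pi_is_linear.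

Definition quo_piece (j : nat) (x : quo) : Prop :=
  exists2 f : {mpoly K[r]}, f \is j.-homog & x = quo_pi f.

Lemma quo_piece_fin_dim j : exists n, has_dim (quo_piece j) n.
Proof.
pose A := [pred m : 'X_{1..r < j.+1} | mdeg m == j].
apply: (@has_dim_span _ _ _ #|A| (fun i => quo_pi 'X_[bmnm (enum_val i)])).
  move=> i; exists 'X_[bmnm (enum_val i)] => //.
  by rewrite dhomogX; have := enum_valP i; rewrite inE.
move=> _ [f fj ->]; exists (fun i => f@_(bmnm (enum_val i))).
have fE : f = \sum_(m in A) f@_(bmnm m) *: 'X_[bmnm m].
  have szf : (msize f <= j.+1)%N.
    rewrite msizeE; apply/bigmax_leqP_seq => m m_f _.
    by rewrite ltnS (dhomog_mf fj m_f).
  rewrite {1}(mpolywE szf) (bigID (mem A)) /= [X in _ + X]big1 ?addr0 // => m.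
  by rewrite inE => mj; rewrite (dhomog_nemf_coeff fj mj) scale0r.
rewrite {1}fE linear_sum /= big_enum_val /=.
by apply: eq_bigr => i _; rewrite linearZ.
Qed.

(* The chosen dimension is the only one, by has_dim_uniq. *)
Definition hilbert_function (j : nat) : nat :=
  projT1 (cid (quo_piece_fin_dim j)).

Lemma hilbert_functionP j : has_dim (quo_piece j) (hilbert_function j).
Proof. exact: projT2 (cid (quo_piece_fin_dim j)). Qed.

End QuotientByIdeal.

Section Ideals.
Variables (K : fieldType) (r : nat).

(* Indices are shifted by one: x_k is 'X_(k-1), with k - 1 in 'I_r. *)
Definition powers : seq {mpoly K[r]} := [seq 'X_i ^+ r | i <- enum 'I_r].

Definition I_gens : seq {mpoly K[r]} := rcons powers (\prod_(i < r) 'X_i).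

Hypothesis hr : (3 <= r)%N.

Fact r_gt0 : (0 < r)%N. Proof. exact: leq_trans hr. Qed.
Fact pred_r_lt : (r.-1 < r)%N. Proof. by rewrite prednK // r_gt0. Qed.

Definition first_var : {mpoly K[r]} := 'X_(Ordinal r_gt0).
Definition last_var : {mpoly K[r]} := 'X_(Ordinal pred_r_lt).

Definition J_gens : seq {mpoly K[r]} :=
  rcons powers
    ((\prod_(i < r | (i < r.-1)%N) 'X_i) * (first_var + last_var)).

End Ideals.

(* Main.v *)
(** The monomials with all exponents below [r] and at least one exponent zero
    form a basis of both quotients. For the monomial ideal [I] this is
    immediate. Modulo [J], a monomial in which only the exponent [b] of the last
    variable may vanish satisfies [x_1^a w x_r^b = (-1)^b x_1^(a+b) w]; applying
    this rule and then discarding the monomials having an exponent [>= r] is a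
    linear projection onto the span of the basis, and it kills all multiples of
    the generators of [J]. *)
From HB Require Import structures.
Require Import Defs.
From mathcomp Require Import all_boot all_algebra.
From mathcomp Require Import mpoly.
From mathcomp Require Import boolp.

Set Implicit Arguments.
Unset Strict Implicit.
Unset Printing Implicit Defensive.

Import GRing.Theory.
Local Open Scope ring_scope.

(** * Linear extension of a map given on monomials *)

Section MonomialExtension.
Variables (K : fieldType) (r : nat) (nf : 'X_{1..r} -> {mpoly K[r]}).

Definition mon_ext (f : {mpoly K[r]}) : {mpoly K[r]} :=
  \sum_(m <- msupp f) f@_m *: nf m.

(** A summation range independent of the support of [f] lets several polynomials be expanded over
    the same monomials; linearity follows from this. *)
Lemma mon_extwE k f : (msize f <= k)%N ->
  mon_ext f = \sum_(m : 'X_{1..r < k}) f@_m *: nf m.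
Proof.
move=> le_fk; rewrite /mon_ext (ssrcomplements.big_mksub 'X_{1..r < k}) //=; first last.
- by move=> m /msize_mdeg_lt /leq_trans; apply.
- exact: msupp_uniq.
by rewrite big_rmcond //= => m; move/memN_msupp_eq0 ->; rewrite scale0r.
Qed.

Lemma mon_ext_is_linear : linear mon_ext.
Proof.
move=> a f g; pose k := maxn (msize (a *: f + g)) (maxn (msize f) (msize g)).
rewrite !(@mon_extwE k) ?leq_max ?leqnn ?orbT //.
rewrite scaler_sumr -big_split; apply: eq_bigr => m _ /=.
by rewrite mcoeffD mcoeffZ scalerDl scalerA.
Qed.

HB.instance Definition _ := GRing.isLinear.Build K {mpoly K[r]} {mpoly K[r]} _
  mon_ext mon_ext_is_linear.

Lemma mon_extX m : mon_ext 'X_[m] = nf m.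
Proof. by rewrite /mon_ext msuppX big_seq1 mcoeffX eqxx scale1r. Qed.

End MonomialExtension.

(** * Ideal membership and linear maps vanishing on an ideal *)

Section IdealMembership.
Variables (K : fieldType) (r : nat) (G : seq {mpoly K[r]}).

Lemma gens_in_ideal g : g \in G -> g \in ideal_of G.
Proof.
move=> /(nthP 0)[i ltiG <-]; apply/asboolP.
exists (fun j => (val j == i)%:R); rewrite (bigD1 (Ordinal ltiG)) //= eqxx mul1r.
by rewrite big1 ?addr0 // => j /negPf; rewrite -val_eqE /= => ->; rewrite mul0r.
Qed.

Lemma ideal_ofZ a f : f \in ideal_of G -> a *: f \in ideal_of G.
Proof. by rewrite -mul_mpolyC; exact: ideal_ofMl. Qed.

(** Since [phi] is only [K]-linear, the polynomial multipliers of the generators are first expanded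
    into monomials. *)
Lemma linear_ideal_eq0 (phi : {linear {mpoly K[r]} -> {mpoly K[r]}}) :
    (forall m g, g \in G -> phi ('X_[m] * g) = 0) ->
  forall f, f \in ideal_of G -> phi f = 0.
Proof.
move=> phiG f /asboolP[c ->]; rewrite linear_sum big1 //= => i _.
rewrite [c i]mpolyE mulr_suml linear_sum big1 //= => m _.
by rewrite -scalerAl linearZ /= phiG ?mem_nth // scaler0.
Qed.

End IdealMembership.

(** * Bases of graded pieces from normal forms *)

Section NormalForm.
Variables (K : fieldType) (r : nat) (G : seq {mpoly K[r]}).
Variables (N : pred 'X_{1..r}) (nf : 'X_{1..r} -> {mpoly K[r]}).
Hypothesis nf_id : forall m, N m -> nf m = 'X_[m].
Hypothesis nf_congr : forall m, 'X_[m] - nf m \in ideal_of G.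
Hypothesis nf_supp : forall m m',
  m' \in msupp (nf m) -> N m' /\ mdeg m' = mdeg m.
Hypothesis nf_gens : forall m g, g \in G -> mon_ext nf ('X_[m] * g) = 0.

(** The classes of the degree [j] monomials in [N] form a basis. They are independent because
    [mon_ext nf] fixes these monomials and kills the ideal; they generate because every [f] is
    congruent to [mon_ext nf f]. The bound [j.+1] only provides a finite type containing all
    monomials of degree [j]. *)
Lemma normal_form_has_dim j :
  has_dim (@quo_piece K r G j)
    #|[pred m : 'X_{1..r < j.+1} | (mdeg m == j) && N m]|.
Proof.
set A := [pred m : 'X_{1..r < j.+1} | (mdeg m == j) && N m].
pose e (i : 'I_#|A|) : 'X_{1..r} := bmnm (enum_val i).
have eA i : mdeg (e i) = j /\ N (e i).
  by have := enum_valP i; rewrite inE => /andP[/eqP].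
have e_inj : injective e by move=> i k /val_inj/enum_val_inj.
exists (fun i => quo_pi G 'X_[e i]); split.
- by move=> i; exists 'X_[e i] => //; rewrite dhomogX /=; have [-> _] := eA i.
- move=> c c0 i.
  have cG : \sum_i c i *: 'X_[e i] \in ideal_of G.
    rewrite -[X in X \in _]subr0; apply/quo_pi_eq.
    rewrite linear_sum linear0 -[RHS]c0; apply: eq_bigr => k _.
    exact: linearZ.
  (* The reduction returns the combination unchanged, so it vanishes as a polynomial and [c i] is
     its coefficient at [e i]. *)
  have := linear_ideal_eq0 (phi := mon_ext nf) nf_gens cG.
  rewrite linear_sum /= => /(congr1 (mcoeff (e i))).
  rewrite mcoeff0 raddf_sum (bigD1 i) //= big1 ?addr0 => [|k ki].
    by rewrite linearZ /= mon_extX nf_id ?mcoeffZ ?mcoeffX ?eqxx ?mulr1 //;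
       have [] := eA i.
  rewrite linearZ /= mon_extX nf_id; last by have [] := eA k.
  by rewrite mcoeffZ mcoeffX (inj_eq e_inj) (negPf ki) mulr0.
move=> _ [f fj ->]; pose h := mon_ext nf f.
have hE : h = \sum_(m in A) h@_(bmnm m) *: 'X_[bmnm m].
  have hA m : m \in msupp h -> mdeg m = j /\ N m.
    move=> /msupp_sum_le /flatten_mapP[m' + /msuppZ_le /nf_supp[Nm ->]].
    by rewrite filter_predT => /(dhomog_mf fj).
  have szh : (msize h <= j.+1)%N.
    by rewrite msizeE; apply/bigmax_leqP_seq => m /hA[-> _] _.
  rewrite {1}(mpolywE szh) (bigID (mem A)) /= [X in _ + X]big1 ?addr0 // => m.
  rewrite inE => mA; rewrite memN_msupp_eq0 ?scale0r //.
  by apply: contra mA => /hA[-> ->]; rewrite eqxx.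
exists (fun i => h@_(e i)).
have -> : quo_pi G f = quo_pi G h.
  apply/quo_pi_eq; rewrite {1}[f]mpolyE -sumrB; apply: rpred_sum => m _.
  by rewrite -scalerBr ideal_ofZ.
rewrite {1}hE linear_sum /= big_enum_val /=.
by apply: eq_bigr => i _; rewrite linearZ.
Qed.

End NormalForm.

(** * Standard monomials and the monomial ideal *)

Section Bases.
Variables (K : fieldType) (r : nat).

Definition bounded (m : 'X_{1..r}) : bool := [forall i, (m i < r)%N].

Definition standard (m : 'X_{1..r}) : bool :=
  bounded m && [exists i, m i == 0%N].

Lemma bounded_powersN m i : ~~ bounded (m + U_(i) *+ r)%MM.
Proof.
by apply/forallPn; exists i; rewrite mnmDE mulmnE mnm1E eqxx mul1n -leqNgt leq_addl.
Qed.

Lemma unbounded_in_ideal (G : seq {mpoly K[r]}) m :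
  {subset powers K r <= G} -> ~~ bounded m -> 'X_[m] \in ideal_of G.
Proof.
move=> sub_powers /forallPn[i]; rewrite -leqNgt => ler.
have le_m : (U_(i) *+ r <= m)%MM.
  apply/mnm_lepP => k; rewrite mulmnE mnm1E.
  by case: eqP => [<-|_]; rewrite ?mul1n ?mul0n.
rewrite -(submK le_m) mpolyXD -mpolyXn; apply/ideal_ofMl/gens_in_ideal.
by apply: sub_powers; apply: map_f; rewrite mem_enum.
Qed.

Definition I_nf (m : 'X_{1..r}) : {mpoly K[r]} :=
  if standard m then 'X_[m] else 0.

Lemma prod_var_mpolyX (P : pred 'I_r) :
  \prod_(i | P i) 'X_i = 'X_[[multinom (P i : nat) | i < r]] :> {mpoly K[r]}.
Proof.
rewrite mpolyXE_id [LHS]big_mkcond; apply: eq_bigr => i _.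
by rewrite mnmE; case: (P i); rewrite ?expr1 ?expr0.
Qed.

Lemma I_has_dim j :
  has_dim (@quo_piece K r (I_gens K r) j)
    #|[pred m : 'X_{1..r < j.+1} | (mdeg m == j) && standard m]|.
Proof.
apply: (@normal_form_has_dim _ _ _ standard I_nf) => [m|m|m m'|m g].
- by rewrite /I_nf => ->.
- rewrite /I_nf; case: ifPn => [_|]; first by rewrite subrr rpred0.
  (* A nonstandard monomial is unbounded or has only positive exponents; in the latter case the
     product of all variables divides it. *)
  rewrite subr0 negb_and => /orP[|/existsPn m_gt0].
    by apply: unbounded_in_ideal => g g_pow; rewrite mem_rcons inE g_pow orbT.
  have le_m : ([multinom 1%N | i < r] <= m)%MM.
    by apply/mnm_lepP => i; rewrite mnmE lt0n m_gt0.
  rewrite -(submK le_m) mpolyXD; apply/ideal_ofMl/gens_in_ideal.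
  by rewrite mem_rcons inE (prod_var_mpolyX predT) eqxx.
- by rewrite /I_nf; case: ifP; rewrite ?msupp0 // msuppX inE => ? /eqP ->.
rewrite mem_rcons inE => /predU1P[->|/mapP[i _ ->]].
  rewrite (prod_var_mpolyX predT) -mpolyXD mon_extX /I_nf ifF //.
  apply/negbTE; rewrite negb_and; apply/orP; right; apply/existsPn => i.
  by rewrite mnmDE mnmE addn1.
by rewrite mpolyXn -mpolyXD mon_extX /I_nf /standard (negPf (bounded_powersN _ _)).
Qed.

(** * Folding the last variable into the first modulo [J_gens] *)

Hypothesis hr : (3 <= r)%N.

Let i0 : 'I_r := Ordinal (r_gt0 hr).
Let il : 'I_r := Ordinal (pred_r_lt hr).

Fact first_neq_last : i0 != il.
Proof. by rewrite -val_eqE /= eq_sym -lt0n -subn1 subn_gt0 (leq_trans _ hr). Qed.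

(* The monomials to which the rule [x_1^a w x_r^b = (-1)^b x_1^(a+b) w]
   applies; [fold_last] is its right-hand side. *)
Definition foldable (m : 'X_{1..r}) : bool :=
  [forall i, (i != il) ==> (0 < m i)%N].

Definition fold_last (m : 'X_{1..r}) : 'X_{1..r} :=
  [multinom if i == i0 then (m i0 + m il)%N else
            if i == il then 0%N else m i | i < r].

Definition trunc (m : 'X_{1..r}) : {mpoly K[r]} :=
  if bounded m then 'X_[m] else 0.

(** Truncation comes after folding, since folding can push the exponent of [i0] up to [r] or
    beyond. *)
Definition J_nf (m : 'X_{1..r}) : {mpoly K[r]} :=
  if foldable m then (-1) ^+ m il *: trunc (fold_last m) else trunc m.

Lemma fold_last_id (m : 'X_{1..r}) : m il = 0%N -> fold_last m = m.
Proof.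
move=> ml0; apply/mnmP => i; rewrite mnmE ml0 addn0.
by case: eqP => [->|_] //; case: eqP => [->|].
Qed.

(** Folding sees the exponents of [i0] and [il] only through their sum. *)
Lemma fold_last_shift m :
  fold_last (m + U_(il))%MM = fold_last (m + U_(i0))%MM.
Proof.
have nl := first_neq_last.
have nl' := nl; rewrite eq_sym in nl'.
apply/mnmP => i; rewrite !mnmE !eqxx (negPf nl) (negPf nl') !addn0.
case: (altP (i =P i0)) => [_|i_n0]; first by rewrite addnA addnAC.
case: (altP (i =P il)) => // i_nl.
by rewrite !(eq_sym _ i) (negPf i_n0) (negPf i_nl).
Qed.

Lemma mdeg_fold_last m : mdeg (fold_last m) = mdeg m.
Proof.
have nl := first_neq_last.
rewrite !mdegE (bigD1 i0) //= [RHS](bigD1 i0) //= (bigD1 il) 1?eq_sym //=.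
rewrite [in RHS](bigD1 il) 1?eq_sym //= !mnmE !eqxx eq_sym (negPf nl) add0n addnA.
congr (_ + _)%N; apply: eq_bigr => i /andP[/negPf n0 /negPf n1].
by rewrite mnmE n0 n1.
Qed.

(** Used in contrapositive form: folding cannot rescue a multiple of some ['X_i ^+ r] from
    truncation. *)
Lemma bounded_fold_last m : bounded (fold_last m) -> bounded m.
Proof.
have nl := first_neq_last.
move=> /forallP bm; apply/forallP => i; move: (bm i) (bm i0).
rewrite !mnmE eqxx.
case: eqP => [-> + _|_]; first exact/leq_trans/leq_addr.
by case: eqP => [-> _|//]; exact/leq_trans/leq_addl.
Qed.

(** Both monomials have the same fold, but their exponents at [il] differ by one, so the signs are
    opposite. *)
Lemma J_nf_var_pair m : foldable (m + U_(il))%MM ->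
  J_nf (m + U_(i0))%MM + J_nf (m + U_(il))%MM = 0.
Proof.
have nl := first_neq_last; move=> fm.
have fm0 : foldable (m + U_(i0))%MM.
  apply/forallP => i; apply/implyP => i_nl; move/forallP/(_ i): fm.
  by rewrite i_nl !mnmDE !mnm1E (eq_sym il) (negPf i_nl) addn0 addn_gt0 => /= ->.
rewrite /J_nf fm fm0 fold_last_shift !mnmDE !mnm1E eqxx (negPf nl) addn0 addn1.
by rewrite exprS mulN1r scaleNr subrr.
Qed.

Lemma J_gen_mpolyX :
  (\prod_(i < r | (i < r.-1)%N) 'X_i) * (first_var K hr + last_var K hr) =
  'X_[[multinom (i < r.-1 : nat)%N | i < r] + U_(i0)] +
  'X_[[multinom (i < r.-1 : nat)%N | i < r] + U_(il)].
Proof. by rewrite (prod_var_mpolyX (fun i => i < r.-1)%N) !mpolyXD mulrDr. Qed.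

Lemma lt_last (i : 'I_r) : (i < r.-1)%N = (i != il).
Proof.
rewrite -val_eqE /= ltn_neqAle; case: eqP => //= _.
by rewrite -ltnS (prednK (r_gt0 hr)) ltn_ord.
Qed.

(** Induction on the exponent of [il]: subtracting a monomial multiple of the last generator trades
    one last variable for minus one first variable. *)
Lemma fold_last_congr m : foldable m ->
  'X_[m] - (-1) ^+ m il *: 'X_[fold_last m] \in ideal_of (J_gens K hr).
Proof.
have nl := first_neq_last.
move: {2}(m il) (erefl (m il)) => b; elim: b m => [|b IHb] m ml fm.
  by rewrite ml expr0 scale1r fold_last_id // subrr rpred0.
(* [d] is the exponent of the product of all variables but the last; it fits below [m] by
   foldability, and [U_(il)] does because [m il] is [b.+1]. *)
pose d := [multinom (i < r.-1 : nat)%N | i < r].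
have le_m : (d + U_(il) <= m)%MM.
  apply/mnm_lepP => i; rewrite mnmDE mnm1E mnmE lt_last.
  by case: eqP => [->|/eqP i_nl]; rewrite ?eqxx ?ml // addnC eq_sym (negPf i_nl);
     move/forallP/(_ i): fm; rewrite i_nl.
pose u := (m - (d + U_(il)))%MM; have mE : m = (u + d + U_(il))%MM.
  by rewrite -addmA submK.
pose m1 := (u + d + U_(i0))%MM.
have m1l : m1 il = b.
  by apply: succn_inj; rewrite -ml mE !mnmDE !mnm1E eqxx (negPf nl) addn0 addn1.
have fm1 : foldable m1.
  apply/forallP => i; apply/implyP => i_nl.
  by rewrite !mnmDE [d i]mnmE lt_last i_nl addn1.
have foldE : fold_last m = fold_last m1 by rewrite mE fold_last_shift.
have -> : 'X_[m] - (-1) ^+ m il *: 'X_[fold_last m] =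
    'X_[u] * ('X_[d + U_(i0)] + 'X_[d + U_(il)]) -
    ('X_[m1] - (-1) ^+ m1 il *: 'X_[fold_last m1]) :> {mpoly K[r]}.
  rewrite mulrDr -!mpolyXD !addmA -/m1 -mE foldE ml m1l exprS mulN1r scaleNr.
  by rewrite opprD !opprK addrACA subrr add0r.
apply: rpredB; last exact: IHb.
rewrite -J_gen_mpolyX; apply/ideal_ofMl/gens_in_ideal.
by rewrite mem_rcons mem_head.
Qed.

Lemma trunc_congr m : 'X_[m] - trunc m \in ideal_of (J_gens K hr).
Proof.
rewrite /trunc; case: ifPn => [_|um]; first by rewrite subrr rpred0.
rewrite subr0; apply: unbounded_in_ideal um => g g_pow.
by rewrite mem_rcons inE g_pow orbT.
Qed.

Lemma J_has_dim j :
  has_dim (@quo_piece K r (J_gens K hr) j)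
    #|[pred m : 'X_{1..r < j.+1} | (mdeg m == j) && standard m]|.
Proof.
have nl := first_neq_last.
apply: (@normal_form_has_dim _ _ _ standard J_nf) => [m|m|m m'|m g].
- move=> /andP[bm /existsP[i /eqP mi0]].
  (* If a standard monomial is foldable, its zero exponent is at [il], and folding leaves it
     unchanged. *)
  rewrite /J_nf /trunc; case: ifP => [/forallP/(_ i)|_]; last by rewrite bm.
  rewrite mi0 implybF negbK => /eqP ei; rewrite ei in mi0.
  by rewrite mi0 expr0 scale1r fold_last_id // bm.
- rewrite /J_nf; case: ifP => fm; last exact: trunc_congr.
  set s := (-1) ^+ m il; set X := 'X_[fold_last m] : {mpoly K[r]}.
  have -> : 'X_[m] - s *: trunc (fold_last m) =
      'X_[m] - s *: X + s *: (X - trunc (fold_last m)).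
    by rewrite scalerBr addrA subrK.
  by apply: rpredD; [exact: fold_last_congr | exact/ideal_ofZ/trunc_congr].
- rewrite /J_nf /trunc; case: ifPn => [fm|/forallPn[i]].
    move=> /msuppZ_le; case: ifP => bm; rewrite ?msupp0 // msuppX inE => /eqP ->.
    rewrite mdeg_fold_last /standard bm; split=> //.
    (* Folding empties the exponent of [il], which supplies the zero that [standard] asks for. *)
    by apply/existsP; exists il; rewrite mnmE eqxx ifN // eq_sym.
  rewrite negb_imply -leqNgt leqn0 => /andP[_ mi0].
  case: ifP => bm; rewrite ?msupp0 // msuppX inE => /eqP ->.
  by split=> //; rewrite /standard bm; apply/existsP; exists i.
rewrite mem_rcons inE => /predU1P[->|/mapP[i _ ->]].
  rewrite J_gen_mpolyX mulrDr -!mpolyXD !addmA linearD /= !mon_extX J_nf_var_pair //.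
  apply/forallP => i; apply/implyP => i_nl.
  by rewrite !mnmDE [X in (_ + X + _)%N]mnmE lt_last i_nl addn1.
rewrite mpolyXn -mpolyXD mon_extX /J_nf /trunc.
have ub := bounded_powersN m i.
case: ifP => _; last by rewrite ifN.
by rewrite ifN ?scaler0 //; apply: contra ub; exact: bounded_fold_last.
Qed.

End Bases.

Theorem lemma5p1 (K : fieldType) (r : nat) (hr : (3 <= r)%N) :
  hilbert_function (@J_gens K r hr) =1 hilbert_function (I_gens K r).
Proof.
(* Both values count the standard monomials of degree [j]. *)
move=> j; rewrite (has_dim_uniq (hilbert_functionP _ j) (J_has_dim K hr j)).
by rewrite (has_dim_uniq (hilbert_functionP _ j) (I_has_dim K r j)).
Qed.
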